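(* Let $\sigma > 0$, let $d \ge 2$ be an integer, and let $X_1, X_2, \dots, X_d$ be independent Gaussian random variables, each with distribution $N(0,\sigma^2)$. Then $$ \mathbf{E}\left[\max_{1 \le i \le d} X_i\right] \ge \sigma \left(1 - \exp\left(-\frac{\sqrt{\ln d}}{6.35}\right)\right)\left(\sqrt{2\ln d - 2\ln\ln d} + \sqrt{\frac{2}{\pi}}\right) - \sqrt{\frac{2}{\pi}}\,\sigma , $$ and moreover the right-hand side satisfies $$ \sigma \left(1 - \exp\left(-\frac{\sqrt{\ln d}}{6.35}\right)\right)\left(\sqrt{2\ln d - 2\ln\ln d} + \sqrt{\frac{2}{\pi}}\right) - \sqrt{\frac{2}{\pi}}\,\sigma \ \ge\ 0.13\,\sigma\sqrt{\ln d} - 0.7\,\sigma . $$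
   Context: $N(0,\sigma^2)$ denotes the Gaussian distribution with mean $0$ and variance $\sigma^2$; $\ln$ is the natural logarithm. *)

(* Defs.v *)
From HB Require Import structures.
From mathcomp Require Import all_boot all_order all_algebra.
From mathcomp Require Import all_classical all_reals all_analysis.

Set Implicit Arguments.
Unset Strict Implicit.
Unset Printing Implicit Defensive.

Import Order.TTheory GRing.Theory Num.Theory.
Import numFieldNormedType.Exports.

Local Open Scope classical_set_scope.
Local Open Scope ring_scope.

(* Mutual (not merely pairwise) independence: the product rule is required for
   every subfamily [J] of the finite family. *)
Definition independent_RVs (disp : measure_display) (T : measurableType disp)
    (R : realType) (P : probability T R) (I : finType)
    (X : I -> {RV P >-> R}) : Prop :=
  forall (J : {set I}) (B : I -> set R),
    (forall i, i \in J -> measurable (B i)) ->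
    P (\bigcap_(i in [set` J]) (X i @^-1` B i)) =
    (\prod_(i in J) P (X i @^-1` B i))%E.

(* [s] is the standard deviation, as in [normal_prob], and is meant to be positive:
   [normal_prob m 0] is the uniform law on [0, 1], not a Dirac mass. The two set
   functions are compared on Borel sets only; their values elsewhere are junk. *)
Definition has_normal_distribution (disp : measure_display)
    (T : measurableType disp) (R : realType) (P : probability T R)
    (X : {RV P >-> R}) (m s : R) : Prop :=
  forall A : set R, measurable A -> distribution P X A = normal_prob m s A.

(* The index type is nonempty by [d_gt0], and the default value of the iterated
   maximum is itself one of the entries, so this is the maximum of all [f i]. *)
Definition max_ord (R : realType) (d : nat) (d_gt0 : (0 < d)%N)
    (f : 'I_d -> R) : R :=
  \big[Num.max/f (Ordinal d_gt0)]_(i < d) f i.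

(* Main.v *)
From HB Require Import structures.
Require Import Defs.
From mathcomp Require Import all_boot all_order all_algebra.
From mathcomp Require Import all_classical all_reals all_analysis.
From mathcomp Require Import measurable_realfun ring lra.

Import Order.TTheory GRing.Theory Num.Theory.
Import numFieldNormedType.Exports.

Local Open Scope classical_set_scope.
Local Open Scope ring_scope.

(** Put L = ln d, a = sqrt (2 L - 2 ln L), t = sigma * a, k = sqrt (2 / pi),
    M = max_i X_i and p = P(X_0 < t).  Where some X_i is at least t we have
    M >= t >= 0, and elsewhere M >= X_0, so E[M^+] >= t (1 - p^d) while M^- is
    at most X_0^- on the event that X_i < t for all i <> 0.  By independence
    E[M^-] <= p^(d-1) E[X_0^-] = p^(d-1) sigma k / 2, which is at most
    p^d sigma k because p >= 1/2.  Bounding the two parts separately makes the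
    integrability of M irrelevant.
    The threshold is chosen so that the density at t is proportional to L / d; a
    Mills-ratio bound then gives d (1 - p) >= sqrt L / 6.35, whence
    p^d <= exp (- sqrt L / 6.35).  *)

(** * Taylor bounds for sine and cosine, giving rational bounds for pi *)

Section trigonometric_bounds.
Context {R : realType}.
Implicit Types x y : R.

(** Drives the chain of bounds below: each Taylor inequality is the sign of the derivative in the
    next one. *)
Lemma derive_ge0_le (f f' : R -> R) x :
  (forall y, is_derive y (1 : R) f (f' y)) -> (forall y, 0 <= y -> 0 <= f' y) ->
  0 <= x -> f 0 <= f x.
Proof.
move=> df f'0 x0; apply: (@ger0_derive1_ndecry R f 0) => //.
- move=> y; rewrite in_itv/= andbT => /ltW y0.
  by have dy := df y; rewrite derive1E derive_val f'0.
- by apply: derivable_within_continuous => y _; apply: ex_derive.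
Qed.

Lemma sin_le_id x : 0 <= x -> sin x <= x.
Proof.
move=> x0; rewrite -subr_ge0.
have := @derive_ge0_le (fun y => y - sin y) (fun y => 1 - cos y) x.
by rewrite sin0 subr0 => h; apply: h.
Qed.

Lemma cos_ge_taylor2 x : 0 <= x -> 1 - x ^+ 2 / 2 <= cos x.
Proof.
move=> x0.
have := @derive_ge0_le (fun y => cos y + y ^+ 2 * 2^-1) (fun y => y - sin y) x.
rewrite cos0 expr0n/= mul0r addr0 => h; suff: 1 <= cos x + x ^+ 2 * 2^-1 by lra.
apply: h => // y; last by move=> y0; rewrite subr_ge0 sin_le_id.
apply: is_derive_eq; rewrite /GRing.scale/=; by field.
Qed.

Lemma sin_ge_taylor3 x : 0 <= x -> x - x ^+ 3 / 6 <= sin x.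
Proof.
move=> x0.
have := @derive_ge0_le (fun y => sin y - y + y ^+ 3 * 6^-1)
  (fun y => cos y - 1 + y ^+ 2 / 2) x.
rewrite sin0 expr0n/= mul0r addr0 subr0 => h.
suff: 0 <= sin x - x + x ^+ 3 * 6^-1 by lra.
apply: h => // y; last by move=> /cos_ge_taylor2; lra.
apply: is_derive_eq; rewrite /GRing.scale/=; by field.
Qed.

(** Otherwise pi / 4 < 7 / 10, so c = cos (pi / 4) >= 1 - 0.49 / 2 >= 3 / 4 and 2 c^2 - 1 > 0,
    whereas cos (pi / 2) = 0. *)
Lemma pi_ge_14_5 : 14 / 5 <= pi :> R.
Proof.
rewrite leNgt; apply/negP => h; have p0 := @pi_gt0 R.
have : cos (pi / 2) = 0 :> R by exact: cos_pihalf.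
have -> : pi / 2 = (pi / 4) *+ 2 :> R by rewrite -mulr_natr; lra.
rewrite cos_mulr2n -mulr_natr.
have y0 : 0 <= pi / 4 :> R by lra.
have y1 : (pi / 4) ^+ 2 <= (7 / 10) ^+ 2 :> R.
  by rewrite ler_pXn2r ?nnegrE//; lra.
have := cos_ge_taylor2 _ y0; move: (cos _) => c c1 c2.
have c3 : 3 / 4 <= c by lra.
nra.
Qed.

(** Otherwise 8 / 5 < pi / 2 and cos (8 / 5) > 0; but sin (4 / 5) >= 0.71 makes 1 - 2 sin^2 (4 / 5)
    negative. *)
Lemma pi_le_16_5 : pi <= 16 / 5 :> R.
Proof.
rewrite leNgt; apply/negP => h.
have : 0 < cos (8 / 5 : R) by apply: cos_gt0_pihalf; lra.
have -> : 8 / 5 = (4 / 5) *+ 2 :> R by rewrite -mulr_natr; lra.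
rewrite cos_mulr2n cos2sin2 -mulr_natr.
have := @sin_ge_taylor3 (4 / 5) ltac:(lra); move: (sin _) => c c1 c2.
have c3 : 71 / 100 <= c by lra.
nra.
Qed.

End trigonometric_bounds.

(** * Elementary estimates for the threshold a as a function of L *)

Section threshold.
Context {R : realType}.
Implicit Types x L : R.

Lemma ln_le_sub1 x : 0 < x -> ln x <= x - 1.
Proof.
move=> x0; have -> : ln x = ln (1 + (x - 1)) by congr ln; ring.
by apply: le_ln1Dx; lra.
Qed.

Lemma ln_ge_1subV x : 0 < x -> 1 - x^-1 <= ln x.
Proof.
move=> x0; have := @ln_le_sub1 x^-1; rewrite invr_gt0 => /(_ x0).
rewrite lnV ?posrE//; lra.
Qed.

Lemma ln2_ge_2_3 : 2 / 3 <= ln 2 :> R.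
Proof.
have h : expR (2 / 3) <= 2 :> R.
  (* Sixteen factors expR (- 1 / 24) >= 23 / 24 suffice, since (23 / 24)^16 is about 0.506. *)
  have e : (23 / 24) ^+ 16 <= expR (- (2 / 3)) :> R.
    have -> : - (2 / 3) = 16%:R * - (1 / 24) :> R by lra.
    rewrite expRM_natl ler_pXn2r ?nnegrE ?expR_ge0//.
    by have := expR_ge1Dx (- (1 / 24) : R); lra.
  have {}e : 1 / 2 <= expR (- (2 / 3)) :> R by apply: le_trans e; lra.
  rewrite -[leRHS]invrK -[leLHS]invrK -expRN lef_pV2 ?posrE ?invr_gt0 ?expR_gt0//.
  lra.
by rewrite -ler_expR lnK// posrE.
Qed.

Lemma ln_nat_ge_2_3 (d : nat) : (2 <= d)%N -> 2 / 3 <= ln d%:R :> R.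
Proof.
move=> d2; apply: le_trans ln2_ge_2_3 _.
by rewrite ler_ln ?posrE ?ltr0n ?ler_nat// (leq_trans _ d2).
Qed.

Definition threshold L := Num.sqrt (2 * L - 2 * ln L).

Lemma threshold_ge0 L : 0 <= threshold L.
Proof. exact: sqrtr_ge0. Qed.

Lemma sqr_threshold L : 0 < L -> threshold L ^+ 2 = 2 * L - 2 * ln L.
Proof. by move=> L0; rewrite sqr_sqrtr//; have := ln_le_sub1 _ L0; lra. Qed.

(** As ln L <= L - 1, the radicand is at least 2, and 1.41^2 < 2. *)
Lemma threshold_ge L : 0 < L -> 141 / 100 <= threshold L.
Proof.
move=> L0; rewrite -(@ler_pXn2r _ 2)// ?nnegrE ?threshold_ge0//.
by rewrite sqr_threshold//; have := ln_le_sub1 _ L0; lra.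
Qed.

Lemma ln_sqrt L : 0 < L -> ln L = 2 * ln (Num.sqrt L).
Proof.
by move=> L0; rewrite -{1}(sqr_sqrtr (ltW L0)) lnXn ?sqrtr_gt0// mulr_natl.
Qed.

(** With s = sqrt L the claim is s^2 >= 4 ln s; by ln s <= s - 1 it reduces to (s - 2)^2 >= 0. *)
Lemma threshold_ge_sqrt L : 0 < L -> Num.sqrt L <= threshold L.
Proof.
move=> L0; rewrite -(@ler_pXn2r _ 2)// ?nnegrE ?threshold_ge0 ?sqrtr_ge0//.
rewrite sqr_threshold// ln_sqrt// -{2}(sqr_sqrtr (ltW L0)).
have := @ln_le_sub1 (Num.sqrt L); rewrite sqrtr_gt0 => /(_ L0).
move: (Num.sqrt L) (ln _) => s l ls; have := sqr_ge0 (s - 2); nra.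
Qed.

(** Source of the constant 6.35: sqrt (2 pi) <= 2.54 and a + 0.52 <= 2.5 sqrt L. The shift 0.52 is
    the Mills-ratio parameter in units of sigma. *)
Lemma threshold_le L : 2 / 3 <= L ->
  Num.sqrt (2 * pi) * (threshold L + 13 / 25) <= 635 / 100 * Num.sqrt L.
Proof.
move=> L23; have L0 : 0 < L by lra.
have s0 : 0 < Num.sqrt L by rewrite sqrtr_gt0.
have ss := sqr_sqrtr (ltW L0).
have lns := ln_ge_1subV _ s0.
have r0 := sqrtr_ge0 (2 * pi : R).
have r1 : Num.sqrt (2 * pi) <= 127 / 50 :> R.
  rewrite -(@ler_pXn2r _ 2)// ?nnegrE//.
  by rewrite sqr_sqrtr; have := @pi_le_16_5 R; have := @pi_gt0 R; lra.
have := sqr_threshold _ L0; rewrite ln_sqrt// -{2}ss.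
have a0 := threshold_ge0 L.
move: (threshold L) (Num.sqrt L) (ln _) s0 ss lns a0 (Num.sqrt _) r0 r1.
move=> a s l s0 ss lns a0 r r0 r1 aa.
have s1 : 13 / 16 <= s.
  by rewrite -(@ler_pXn2r _ 2)// ?nnegrE ?(ltW s0)//; lra.
have sv : s^-1 * s = 1 by rewrite mulVf// gt_eqF.
(* [127 / 50 * (5 / 2) = 635 / 100] *)
have a1 : a <= 5 / 2 * s - 13 / 25.
  rewrite -(@ler_pXn2r _ 2)// ?nnegrE//; last lra.
  (* By ln s >= 1 - 1 / s, a^2 = 2 s^2 - 4 ln s is at most the first factor; multiplying by s clears
     the inverse. *)
  suff : (2 * s ^+ 2 - 4 * (1 - s^-1)) * s <= (5 / 2 * s - 13 / 25) ^+ 2 * s.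
    rewrite ler_pM2r//; lra.
  have -> : (2 * s ^+ 2 - 4 * (1 - s^-1)) * s =
    2 * s ^+ 3 - 4 * s + 4 * (s^-1 * s) by ring.
  (* Expanded in powers of s - 13 / 16, the difference of the two cubics has only positive
     coefficients. *)
  have u0 : 0 <= s - 13 / 16 by lra.
  have u2 := exprn_ge0 2 u0; have u3 := exprn_ge0 3 u0.
  rewrite sv; lra.
apply: le_trans (_ : 127 / 50 * (a + 13 / 25) <= _); last lra.
by apply: ler_wpM2r => //; lra.
Qed.

(** Put s = sqrt L and e = exp (- s / 6.35). From exp x >= 1 + x follows 1 - e >= s / (s + 6.35);
    clearing that denominator leaves (0.13 s - 0.7) (s + 6.35) <= s a - 6.35 k. *)
Lemma simplified_lower_bound L (k := Num.sqrt (2 / pi)) : 2 / 3 <= L ->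
  13 / 100 * Num.sqrt L - 7 / 10 <=
  (1 - expR (- (Num.sqrt L / (635 / 100)))) * (threshold L + k) - k.
Proof.
move=> L23; have L0 : 0 < L by lra.
have k0 : 0 <= k by exact: sqrtr_ge0.
have k1 : k <= 11 / 13.
  rewrite -(@ler_pXn2r _ 2)// ?nnegrE//.
  have pi0 := @pi_gt0 R; rewrite sqr_sqrtr ?divr_ge0 ?(ltW pi0)//.
  by rewrite ler_pdivrMr//; have := @pi_ge_14_5 R; lra.
have s0 : 0 < Num.sqrt L by rewrite sqrtr_gt0.
have ss := sqr_sqrtr (ltW L0).
have a0 := threshold_ge _ L0.
have as0 := threshold_ge_sqrt _ L0.
have e0 := expR_ge0 (- (Num.sqrt L / (635 / 100))).
have e1 : expR (- (Num.sqrt L / (635 / 100))) * (1 + Num.sqrt L / (635 / 100)) <= 1.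
  rewrite -[leRHS](expRxMexpNx_1 (Num.sqrt L / (635 / 100))) mulrC.
  by apply: ler_wpM2r => //; exact: expR_ge1Dx.
move: k (threshold L) (Num.sqrt L) (expR _) k0 k1 s0 ss a0 as0 e0 e1.
move=> k a s e k0 k1 s0 ss a0 as0 e0 e1.
have s1 : 13 / 16 <= s.
  by rewrite -(@ler_pXn2r _ 2)// ?nnegrE ?(ltW s0)//; lra.
have e2 : s <= (1 - e) * (s + 635 / 100) by lra.
rewrite -(@ler_pM2r _ (s + 635 / 100)); last lra.
apply: le_trans (_ : s * (a + k) - k * (s + 635 / 100) <= _); last first.
  rewrite mulrBl lerD2r mulrAC.
  by apply: ler_wpM2r => //; lra.
(* [a >= 1.41] suffices for small [s], [a >= s] for large [s]. *)
have [s2|s2] := leP s 2.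
  have : s * (141 / 100) <= s * a by rewrite ler_pM2l.
  have := mulr_ge0 (_ : 0 <= s - 13 / 16) (_ : 0 <= 2 - s).
  by move=> /(_ ltac:(lra) ltac:(lra)); lra.
have : s * s <= s * a by rewrite ler_pM2l.
have := mulr_ge0 (_ : 0 <= s - 2) (_ : 0 <= s - 2).
by move=> /(_ ltac:(lra) ltac:(lra)); lra.
Qed.

End threshold.

(** * The centred normal law: density, tail and negative part *)

Section normal_law.
Context {R : realType}.
Variable s : R.
Hypothesis s_gt0 : 0 < s.
Local Notation mu := (@lebesgue_measure R).
Local Notation pdf := (normal_pdf 0 s).

Lemma normal_pdf0E x :
  pdf x = normal_peak s * expR (- ((2 * s ^+ 2)^-1 * x ^+ 2)).
Proof.
rewrite normal_pdfE ?gt_eqF// /normal_fun subr0; congr (_ * expR _).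
by rewrite mulNr mulrC mulr_natl.
Qed.

Lemma is_derive_normal_pdf0 x : is_derive x (1 : R) pdf (- (x / s ^+ 2 * pdf x)).
Proof.
rewrite (_ : pdf = fun y => normal_peak s * expR (- ((2 * s ^+ 2)^-1 * y ^+ 2))); last first.
  by apply/funext => y; exact: normal_pdf0E.
apply: is_derive_eq; rewrite /GRing.scale/=.
have := gt_eqF s_gt0; move: (expR _) => e s0.
by field; rewrite s0.
Qed.

Lemma normal_pdf0_even x : pdf (- x) = pdf x.
Proof. by rewrite !normal_pdf0E sqrrN. Qed.

Lemma normal_pdf0_cvgy : pdf x @[x --> +oo] --> (0 : R).
Proof.
have -> : pdf = (fun x => normal_peak s * gauss_fun (x * (Num.sqrt 2 * s)^-1)).
  apply/funext => x; rewrite normal_pdf0E /gauss_fun; congr (_ * expR (- _)).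
  by rewrite exprMn exprVn exprMn sqr_sqrtr// mulrC.
rewrite -(mulr0 (normal_peak s)); apply: cvgM; first exact: cvg_cst.
apply: (cvg_comp (fun x => x * (Num.sqrt 2 * s)^-1) gauss_fun); last exact: cvg_gauss_fun.
by apply/gt0_cvgMly; [rewrite invr_gt0 mulr_gt0// sqrtr_gt0 | exact: cvg_id].
Qed.

(** The Radon-Nikodym derivative agrees almost everywhere with [pdf], both having the same integral
    over every measurable set. *)
Lemma ge0_integral_normal_prob (f : R -> \bar R) :
  measurable_fun [set: R] f -> (forall x, 0 <= f x)%E ->
  (\int[normal_prob 0 s]_x f x = \int[mu]_x (f x * (pdf x)%:E))%E.
Proof.
move=> mf f0.
rewrite -(Radon_Nikodym_SigmaFinite.change_of_variables (normal_prob_dominates 0 s))//=.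
apply: ae_eq_integral => //.
- apply: emeasurable_funM => //; apply: (measurable_int mu).
  exact: Radon_Nikodym_SigmaFinite.f_integrable (normal_prob_dominates 0 s).
- apply: emeasurable_funM => //; apply/measurable_EFinP.
  exact: measurable_normal_pdf.
- apply: ae_eqe_mul2l => /=.
  apply: integral_ae_eq => //=.
  + exact: Radon_Nikodym_SigmaFinite.f_integrable (normal_prob_dominates 0 s).
  + by apply/measurable_EFinP; exact: measurable_normal_pdf.
  + move=> E _ mE.
    by rewrite -(Radon_Nikodym_SigmaFinite.f_integral (normal_prob_dominates 0 s)).
Qed.

(** The integrand has the antiderivative - s^2 [pdf], which vanishes at infinity. *)
Lemma integral_id_normal_pdf0 :
  (\int[mu]_(x in `[0%R, +oo[) (x * pdf x)%:E = (s ^+ 2 * pdf 0)%:E)%E.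
Proof.
rewrite (@ge0_continuous_FTC2y _ _ (fun x => - (s ^+ 2 * pdf x)) 0
  (- (s ^+ 2 * 0))).
- by rewrite mulr0 oppr0 sub0e -EFinN opprK.
- by move=> x x0; rewrite mulr_ge0 ?normal_pdf_ge0.
- apply: continuous_subspaceT => x; apply: cvgM; first exact: cvg_id.
  by apply: continuous_normal_pdf; rewrite gt_eqF.
- apply: cvgN; apply: cvgM; first exact: cvg_cst.
  exact: normal_pdf0_cvgy.
- move=> x _; have dx := is_derive_normal_pdf0 x.
  by apply: ex_derive.
- apply: cvg_at_right_filter; apply: cvgN; apply: cvgM; first exact: cvg_cst.
  by apply: continuous_normal_pdf; rewrite gt_eqF.
- move=> x _; have dx := is_derive_normal_pdf0 x.
  rewrite derive1E derive_val /GRing.scale/=.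
  by field; rewrite gt_eqF.
Qed.

(* [s ^+ 2 * pdf x / (x + c)] has derivative at least [- pdf x] for [x >= t]:
   a Mills-ratio bound with the parameter [c] free. *)
Lemma normal_prob_tail (t c : R) : 0 <= t -> 0 < c -> s ^+ 2 <= c * (t + c) ->
  ((s ^+ 2 * pdf t / (t + c))%:E <= normal_prob 0 s `[t, +oo[)%E.
Proof.
move=> t0 c0 sc.
pose g x := pdf x * (x / (x + c) + s ^+ 2 / (x + c) ^+ 2).
have xc0 x : t <= x -> 0 < x + c by lra.
have cpdf : continuous pdf by apply: continuous_normal_pdf; rewrite gt_eqF.
have g0 x : t <= x -> 0 <= g x.
  move=> tx; have xc := xc0 _ tx.
  by rewrite mulr_ge0 ?normal_pdf_ge0// addr_ge0// divr_ge0 ?sqr_ge0//; lra.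
have cx x : t <= x -> {for x, continuous (fun y => (y + c)^-1)}.
  move=> tx; apply: cvgV; first by rewrite gt_eqF// xc0.
  by apply: cvgD; [exact: cvg_id|exact: cvg_cst].
have cg x : t <= x -> {for x, continuous g}.
  move=> tx; apply: cvgM; first exact: cpdf.
  apply: cvgD; first by apply: cvgM; [exact: cvg_id|exact: cx].
  apply: cvgM; first exact: cvg_cst.
  under eq_fun do rewrite -exprVn.
  rewrite -exprVn; by apply: (cvg_comp _ (fun x => x ^+ 2)); [exact: cx|exact: sqr_continuous].
have cwg : {within `[t, +oo[, continuous g}.
  apply/continuous_within_itvcyP; split; last first.
    by apply: cvg_at_right_filter; exact: cg.
  by move=> x; rewrite in_itv/= andbT => /ltW; exact: cg.
have dF x : t <= x ->
    is_derive x (1 : R) (fun y => - (s ^+ 2 * (pdf y * (y + c)^-1))) (g x).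
  move=> tx; have dx := is_derive_normal_pdf0 x.
  have xcn0 : x + c != 0 by rewrite gt_eqF// xc0.
  have dV : is_derive x (1 : R) (fun y => (y + c)^-1) (- (x + c) ^- 2 *: (1 + 0)).
    by apply: is_deriveV.
  apply: is_derive_eq; rewrite /GRing.scale/= /g.
  by field; rewrite xcn0 gt_eqF.
have cvgF : - (s ^+ 2 * (pdf x * (x + c)^-1)) @[x --> +oo] --> - (s ^+ 2 * 0).
  apply: cvgN; apply: cvgM; first exact: cvg_cst.
  apply: (@squeeze_cvgr _ _ _ _ (cst 0) (fun x => pdf x * c^-1)).
  - near=> x; have x0 : 0 <= x by near: x; exact: nbhs_pinfty_ge.
    rewrite mulr_ge0 ?normal_pdf_ge0 ?invr_ge0 ?addr_ge0 ?(ltW c0)//=.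
    by rewrite ler_wpM2l ?normal_pdf_ge0// lef_pV2 ?posrE; lra.
  - exact: cvg_cst.
  - rewrite -[X in _ --> X](mul0r c^-1); apply: cvgM; last exact: cvg_cst.
    exact: normal_pdf0_cvgy.
have <- : (\int[mu]_(x in `[t, +oo[) (g x)%:E = (s ^+ 2 * pdf t / (t + c))%:E)%E.
  rewrite (@ge0_continuous_FTC2y _ _ (fun x => - (s ^+ 2 * (pdf x * (x + c)^-1))) t
    (- (s ^+ 2 * 0)))//.
  - by rewrite mulr0 oppr0 sub0e -EFinN opprK mulrA.
  - by move=> x /ltW tx; have := dF _ tx => ?; apply: ex_derive.
  - apply: cvg_at_right_filter; apply: cvgN; apply: cvgM; first exact: cvg_cst.
    by apply: cvgM; [exact: cpdf|exact: cx].
  - move=> x; rewrite in_itv/= andbT => /ltW tx; have := dF _ tx => ?.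
    by rewrite derive1E derive_val.
rewrite /normal_prob; apply: ge0_le_integral => //=.
- by move=> x; rewrite in_itv/= andbT lee_fin => /g0.
- by apply/measurable_EFinP; exact: subspace_continuous_measurable_fun.
- by apply/measurable_EFinP/measurable_funTS; exact: measurable_normal_pdf.
- move=> x; rewrite in_itv/= andbT lee_fin => tx.
  rewrite /g ler_piMr ?normal_pdf_ge0//.
  have xc := xc0 _ tx.
  (* The factor of [pdf x] is at most 1 once s^2 <= c (x + c), which for x >= t follows from the
     hypothesis at t. *)
  have -> : x / (x + c) + s ^+ 2 / (x + c) ^+ 2 =
    1 - (c * (x + c) - s ^+ 2) / (x + c) ^+ 2 by field; rewrite gt_eqF.
  rewrite gerBl divr_ge0 ?sqr_ge0// subr_ge0 (le_trans sc)//.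
  by rewrite ler_pM2l// lerD2r.
Unshelve. all: by end_near.
Qed.

(** By evenness of the density, half of the mass lies on the nonpositive half-line. *)
Lemma normal_prob_ge_half (t : R) : 0 < t -> ((1 / 2)%:E <= normal_prob 0 s `]-oo, t[)%E.
Proof.
move=> t0; have sn0 : s != 0 by rewrite gt_eqF.
apply: (@le_trans _ _ (normal_prob 0 s `]-oo, 0])); last first.
  apply: le_measure; rewrite ?inE//.
  by apply: subset_itvl; rewrite bnd_simp.
have := @integral_normal_pdf R 0 s.
rewrite ge0_symfun_integralT//; last 3 first.
- exact: normal_pdf_ge0.
- exact: continuous_normal_pdf.
- by move=> x /=; rewrite normal_pdf0_even.
rewrite /normal_prob -{3}oppr0 ge0_integration_by_substitutionNy; last 2 first.
- by apply: continuous_subspaceT; exact: continuous_normal_pdf.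
- by move=> x _; exact: normal_pdf_ge0.
rewrite set_itvcy.
under [in X in _ -> X]eq_integral do rewrite /= normal_pdf0_even.
(* An infinite value needs no separate exclusion: +oo satisfies the goal, and -oo contradicts total
   mass 1. *)
case: (\int[mu]_(_ in _) _)%E => [r| |].
- by rewrite -EFinM => -[h]; rewrite lee_fin; lra.
- by move=> _; rewrite leey.
- by rewrite gt0_muleNy// lte_fin.
Qed.

Lemma expectation_normal_neg :
  (\int[normal_prob 0 s]_x (Num.max (- x) 0)%:E = (s ^+ 2 * pdf 0)%:E)%E.
Proof.
rewrite ge0_integral_normal_prob; last 2 first.
- by apply/measurable_EFinP; apply: measurable_maxr => //; exact: measurable_oppr.
- by move=> x; rewrite lee_fin le_max lexx orbT.
rewrite -integral_id_normal_pdf0.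
(* The endpoint is written [- 0] to fit the reflection formula for x -> - x. *)
transitivity (\int[mu]_(x in `]-oo, (- 0)%R]) (- x * pdf x)%:E)%E.
  rewrite [RHS]integral_mkcond; apply: eq_integral => x _ /=.
  rewrite patchE oppr0 mem_setE in_itv/=; have [x0|x0] := leP x 0.
    by rewrite -EFinM max_l// oppr_ge0.
  by rewrite max_r ?mul0e// oppr_le0 ltW.
rewrite ge0_integration_by_substitutionNy.
- by apply: eq_integral => x _ /=; rewrite opprK normal_pdf0_even.
- apply: continuous_subspaceT => x; apply: cvgM; first by apply: cvgN; exact: cvg_id.
  by apply: continuous_normal_pdf; rewrite gt_eqF.
- move=> x; rewrite in_itv/= oppr0 => x0.
  by rewrite mulr_ge0 ?normal_pdf_ge0// oppr_ge0 ltW.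
Qed.

End normal_law.

(** * The maximum of independent variables: positive and negative parts *)

Section expectation_max.
Context {R : realType} (disp : measure_display) (T : measurableType disp).
Variable P : probability T R.
Local Open Scope ereal_scope.

(** The layer-cake formula for unbundled functions, so that it applies directly to products with
    indicators and to negative parts. *)
Lemma ge0_integral_ccdf (Y : T -> R) : measurable_fun setT Y ->
  (forall w, 0 <= Y w)%R ->
  \int[P]_w (Y w)%:E =
  \int[lebesgue_measure]_(r in `[0%R, +oo[) P (Y @^-1` `]r, +oo[).
Proof.
move=> mY Y0.
pose mixY := isMeasurableFun.Build _ _ _ _ _ mY.
pose Z : {RV P >-> R} := HB.pack Y mixY.
by have := @ge0_expectation_ccdf _ _ _ P Z Y0; rewrite unlock.
Qed.

(* Layer-cake form of [E[Y 1_A] = E[Y] P(A)]: only the tail events of [Y] have to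
   be independent of [A]. *)
Lemma ge0_integral_indep_event (Y : T -> R) (A : set T) : measurable_fun setT Y ->
  (forall w, 0 <= Y w)%R -> measurable A ->
  (forall r, (0 <= r)%R ->
    P ((Y @^-1` `]r, +oo[) `&` A) = P (Y @^-1` `]r, +oo[) * P A) ->
  \int[P]_(w in A) (Y w)%:E = (\int[P]_w (Y w)%:E) * P A.
Proof.
move=> mY Y0 mA YA.
transitivity (\int[P]_w (Y w * \1_A w)%R%:E).
  rewrite integral_mkcond; apply: eq_integral => w _.
  by rewrite patchE indicE; case: ifP => _; rewrite ?mulr1 ?mulr0.
rewrite [LHS]ge0_integral_ccdf; last 2 first.
- by apply: measurable_funM => //; exact: measurable_indic.
- by move=> w; rewrite mulr_ge0// indicE ler0n.
rewrite ge0_integral_ccdf// -ge0_integralZr//; last first.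
  apply: measurable_funTS.
  pose mixY := isMeasurableFun.Build _ _ _ _ _ mY.
  pose Z : {RV P >-> R} := HB.pack Y mixY.
  exact: (ccdf_measurable Z).
apply: eq_integral => r; rewrite inE/= in_itv/= andbT => r0.
(* Because r >= 0, the truncated variable can exceed r only inside A. *)
rewrite -YA//; congr (P _); apply/seteqP; split => w /=; rewrite indicE !in_itv/= !andbT.
  case: (boolP (w \in A)); rewrite ?mulr1 ?mulr0; first by rewrite inE.
  by rewrite ltNge r0.
by move=> [rY Aw]; rewrite mem_set// mulr1.
Qed.

Context {d : nat} (d_gt0 : (0 < d)%N) (X : 'I_d -> {RV P >-> R}).
Hypothesis X_indep : independent_RVs X.
Local Notation i0 := (Ordinal d_gt0).
Local Notation M := (fun w => max_ord d_gt0 (fun i => X i w)).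

Let M_ge i w : (X i w <= M w)%R.
Proof. exact: le_bigmax. Qed.

Lemma measurable_max_ord : measurable_fun setT M.
Proof.
rewrite /max_ord; elim: (index_enum _) => [|i r ih].
  by under eq_fun do rewrite big_nil; exact: measurable_funP.
under eq_fun do rewrite big_cons.
by apply: measurable_maxr => //; exact: measurable_funP.
Qed.

Lemma expectation_max_ge (p m t : R) : (0 <= t)%R ->
  (forall i, P (X i @^-1` `]-oo, t[) = p%:E) ->
  \int[P]_w (Num.max (- X i0 w) 0)%:E = m%:E ->
  (t * (1 - p ^+ d) - m * p ^+ d.-1)%:E <= 'E_P[M].
Proof.
move=> t0 Xp Xm; rewrite unlock integralE.
have mX i (B : set R) : measurable B -> measurable (X i @^-1` B).
  by move=> mB; rewrite -[X in measurable X]setTI; exact: measurable_funP.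
have mbigcap (J : {set 'I_d}) (B : 'I_d -> set R) : (forall i, measurable (B i)) ->
    measurable (\bigcap_(i in [set` J]) X i @^-1` B i).
  by move=> mB; apply: fin_bigcap_measurable => // i _; exact: mX.
have mM := measurable_max_ord.
rewrite EFinB; apply: leeB.
(* Positive part: off the event A that every entry is below t, the maximum is at least t. *)
- set A := \bigcap_(i in [set` [set: 'I_d]%SET]) X i @^-1` `]-oo, t[.
  have mA : measurable A by exact: mbigcap.
  have PA : P A = (p ^+ d)%:E.
    rewrite X_indep//; under eq_bigr do rewrite Xp.
    by rewrite prodEFin prodr_const cardsT card_ord.
  apply: (@le_trans _ _ (\int[P]_(w in ~` A) t%:E)).
    rewrite integral_cst//=; last exact: measurableC.
    by rewrite probability_setC// PA -EFinB -EFinM.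
  apply: (@le_trans _ _ (\int[P]_(w in ~` A) (EFin \o M)^\+ w)); last first.
    apply: ge0_subset_integral => //; first exact: measurableC.
    by apply: measurable_funepos; exact/measurable_EFinP.
  apply: ge0_le_integral => //.
  + exact: measurableC.
  + by apply: measurable_funTS; apply: measurable_funepos; exact/measurable_EFinP.
  + move=> w nAw; rewrite funeposE le_max; apply/orP; left.
    rewrite lee_fin leNgt; apply: contra_notN nAw => Mt i _ /=.
    by rewrite in_itv/= (le_lt_trans (M_ge i w)).
(* Negative part: the index [i0] is left out of A to make A independent of [X i0]. *)
- set A := \bigcap_(i in [set` [set~ i0]%SET]) X i @^-1` `]-oo, t[.
  have mA : measurable A by exact: mbigcap.
  have PA : P A = (p ^+ d.-1)%:E.
    rewrite X_indep//; under eq_bigr do rewrite Xp.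
    by rewrite prodEFin prodr_const cardsC1 card_ord.
  have mN : measurable_fun setT (fun w => Num.max (- X i0 w) 0)%R.
    by apply: measurable_maxr => //; exact: measurableT_comp.
  rewrite EFinM -Xm -PA -ge0_integral_indep_event//; last 2 first.
  + by move=> w; rewrite le_max lexx orbT.
  + move=> r r0.
    (* For r >= 0 the negative part of [X i0] exceeds r exactly when [X i0] < - r, so the
       intersection with A is again a product event. *)
    pose B i : set R := if i == i0 then `]-oo, (- r)%R[%classic else `]-oo, t[%classic.
    have mB i : measurable (B i) by rewrite /B; case: ifP.
    have BE : (fun w => Num.max (- X i0 w) 0)%R @^-1` `]r, +oo[ = X i0 @^-1` B i0.
      rewrite /B eqxx; apply/seteqP; split => w /=; rewrite !in_itv/= andbT lt_max.
        by rewrite [(r < 0)%R]ltNge r0 orbF ltrNr.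
      by rewrite ltrNr => ->.
    rewrite BE.
    have -> : (X i0 @^-1` B i0) `&` A =
        \bigcap_(i in [set` [set: 'I_d]%SET]) X i @^-1` B i.
      apply/seteqP; split => w.
        move=> [w0 Aw] i _; rewrite /B; case: ifPn => [/eqP ->|ii0].
          by move: w0; rewrite /B eqxx.
        by apply: Aw; rewrite /= !inE.
      move=> Bw; split; first by apply: Bw; rewrite /= inE.
      move=> i; rewrite /= !inE => ii0.
      by have := Bw i; rewrite /= inE /B (negbTE ii0); exact.
    rewrite !X_indep// (bigD1 i0) ?inE//=; congr (_ * _).
    apply: eq_big => [i|i]; first by rewrite !inE.
    by rewrite inE /B => /andP[_ /negbTE ->].
  (* On A the maximum dominates [X i0]; off A it is at least t >= 0 and its negative part
     vanishes. *)
  rewrite [leRHS]integral_mkcond; apply: ge0_le_integral => //.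
  + by apply: measurable_funeneg; exact/measurable_EFinP.
  + by apply/(measurable_restrictT _ _).1 => //; apply: measurable_funTS; exact/measurable_EFinP.
  + move=> w _; rewrite patchE; case: ifPn => [_|].
      rewrite funenegE/= -EFin_max lee_fin ge_max !le_max lexx orbT andbT.
      by rewrite lerN2 M_ge.
    move=> nAw; rewrite funenegE/= max_r// lee_fin oppr_le0 leNgt.
    apply: contraNN nAw => M0; rewrite inE => i _ /=.
    by rewrite in_itv/= (lt_le_trans _ t0)// (le_lt_trans (M_ge i w)).
Qed.

End expectation_max.

(** * The normal law evaluated at the threshold *)

Section gaussian_threshold.
Context {R : realType}.
Variable s : R.
Hypothesis s_gt0 : 0 < s.
Local Notation pdf := (normal_pdf 0 s).

Lemma normal_peakE : s * normal_peak s = (Num.sqrt (2 * pi))^-1.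
Proof.
rewrite /normal_peak -mulrnAr sqrtrM ?sqr_ge0// sqrtr_sqr gtr0_norm//.
by rewrite invfM mulrA divff ?gt_eqF// mul1r mulr_natl.
Qed.

(** Rewrites the mean of the negative part as sigma k / 2. *)
Lemma sqrM_normal_pdf0 : s ^+ 2 * pdf 0 = s * Num.sqrt (2 / pi) / 2.
Proof.
have pi0 := @pi_gt0 R.
have h : Num.sqrt (2 / pi) * Num.sqrt (2 * pi) = 2 :> R.
  rewrite -sqrtrM ?divr_ge0 ?(ltW pi0)//.
  have -> : 2 / pi * (2 * pi) = 2 ^+ 2 :> R.
    by move: pi pi0 => x x0; field; rewrite gt_eqF.
  by rewrite sqrtr_sqr ger0_norm.
rewrite normal_pdf0E// expr0n/= mulr0 oppr0 expR0 mulr1 expr2 -mulrA normal_peakE.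
have r0 : Num.sqrt (2 * pi) != 0 :> R by rewrite gt_eqF// sqrtr_gt0 mulr_gt0.
have -> : (Num.sqrt (2 * pi))^-1 = Num.sqrt (2 / pi) / 2 :> R.
  by apply: (mulIf r0); rewrite mulVf// mulrAC h divff.
by rewrite mulrA.
Qed.

(** The exponent is - a^2 / 2 = ln L - L, and exp (- L) = 1 / d. *)
Lemma normal_pdf0_threshold (d : nat) : (2 <= d)%N ->
  s * pdf (s * threshold (ln d%:R)) = (Num.sqrt (2 * pi))^-1 * (ln d%:R / d%:R).
Proof.
move=> d2; have L0 : 0 < ln d%:R :> R by have := @ln_nat_ge_2_3 R _ d2; lra.
rewrite normal_pdf0E// mulrA normal_peakE exprMn sqr_threshold//; congr (_ * _).
have -> : - ((2 * s ^+ 2)^-1 * (s ^+ 2 * (2 * ln d%:R - 2 * ln (ln d%:R)))) =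
    ln (ln d%:R) - ln d%:R by field; rewrite gt_eqF.
by rewrite expRB !lnK ?posrE// ltr0n (leq_trans _ d2).
Qed.

Lemma normal_cdf_threshold_pow_le (d : nat) (p : R) : (2 <= d)%N ->
  normal_prob 0 s `]-oo, (s * threshold (ln d%:R))[ = p%:E ->
  p ^+ d <= expR (- (Num.sqrt (ln d%:R) / (635 / 100))).
Proof.
move=> d2 pE.
have L23 := @ln_nat_ge_2_3 R _ d2.
have d0 : 0 < d%:R :> R by rewrite ltr0n (leq_trans _ d2).
set L := ln _ in L23 pE *; have L0 : 0 < L by lra.
have a1 := threshold_ge _ L0.
have p0 : 0 <= p by rewrite -lee_fin -pE.
have t0 : 0 <= s * threshold L by rewrite mulr_ge0 ?threshold_ge0// ltW.
(* The Mills-ratio parameter is c = 0.52 sigma: with a >= 1.41, its condition holds because 0.52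
   (1.41 + 0.52) = 1.0036 > 1. *)
have c0 : 0 < s * (13 / 25) by rewrite mulr_gt0//; lra.
have ct : s ^+ 2 <= s * (13 / 25) * (s * threshold L + s * (13 / 25)).
  rewrite -mulrDr mulrACA -expr2.
  by rewrite ler_peMr ?sqr_ge0//; lra.
have := normal_prob_tail _ s_gt0 _ _ t0 c0 ct.
have -> : normal_prob 0 s `[(s * threshold L), +oo[ = (1 - p)%:E.
  by rewrite EFinB -pE -setCitvl; exact: probability_setC.
rewrite lee_fin.
have -> : s ^+ 2 * pdf (s * threshold L) / (s * threshold L + s * (13 / 25)) =
    s * pdf (s * threshold L) / (threshold L + 13 / 25).
  rewrite -mulrDr; have : threshold L + 13 / 25 != 0 by rewrite gt_eqF//; lra.
  by move: (_ + _) => x x0; field; rewrite x0 gt_eqF.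
rewrite normal_pdf0_threshold// -/L => q.
have {}q : Num.sqrt L / (635 / 100) <= d%:R * (1 - p).
  apply: le_trans (ler_wpM2l (ltW d0) q).
  have := threshold_le _ L23.
  have ss := sqr_sqrtr (ltW L0); have : 0 < Num.sqrt L by rewrite sqrtr_gt0.
  have : 0 < Num.sqrt (2 * pi) :> R by rewrite sqrtr_gt0 mulr_gt0// pi_gt0.
  rewrite -{5}ss.
  have : 0 < threshold L + 13 / 25 by lra.
  move: (Num.sqrt (2 * pi)) (Num.sqrt L) (_ + _) => r y x x0 r0 y0 le.
  have -> : d%:R * (r^-1 * (y ^+ 2 / d%:R) / x) = y * (y / (r * x)).
    by field; rewrite !gt_eqF.
  rewrite ler_pM2l// ler_pdivlMr ?mulr_gt0// mulrC ler_pdivrMr; last lra.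
  by rewrite [leRHS]mulrC.
(* Uses p = 1 - (1 - p) <= exp (- (1 - p)). *)
apply: (@le_trans _ _ (expR (- (1 - p)) ^+ d)).
  rewrite lerXn2r ?nnegrE ?expR_ge0//.
  by have := expR_ge1Dx (- (1 - p)); lra.
by rewrite -expRM_natl ler_expR mulrN lerN2.
Qed.

End gaussian_threshold.

Theorem theorem3 (R : realType) (sigma : R) (sigma_gt0 : 0 < sigma)
    (d : nat) (d_ge2 : (2 <= d)%N)
    (disp : measure_display) (T : measurableType disp) (P : probability T R)
    (X : 'I_d -> {RV P >-> R})
    (X_indep : independent_RVs X)
    (X_normal : forall i, has_normal_distribution (X i) 0 sigma) :
  (('E_P[fun w => max_ord (ltnW d_ge2) (fun i => X i w)] >=
    (sigma * (1 - expR (- (Num.sqrt (ln d%:R) / (635 / 100))))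
           * (Num.sqrt (2 * ln d%:R - 2 * ln (ln d%:R)) + Num.sqrt (2 / pi))
     - Num.sqrt (2 / pi) * sigma)%:E)%E)
  /\
  sigma * (1 - expR (- (Num.sqrt (ln d%:R) / (635 / 100))))
        * (Num.sqrt (2 * ln d%:R - 2 * ln (ln d%:R)) + Num.sqrt (2 / pi))
  - Num.sqrt (2 / pi) * sigma
  >= 13 / 100 * sigma * Num.sqrt (ln d%:R) - 7 / 10 * sigma.
Proof.
have L23 := @ln_nat_ge_2_3 R _ d_ge2.
have L0 : 0 < ln d%:R :> R by lra.
have a1 := threshold_ge _ L0.
split; last first.
  have := ler_wpM2l (ltW sigma_gt0) (simplified_lower_bound _ L23).
  rewrite /threshold; lra.
pose i0 := Ordinal (ltnW d_ge2).
pose t := sigma * threshold (ln d%:R).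
have t0 : 0 < t by rewrite mulr_gt0//; lra.
pose p := fine (normal_prob 0 sigma `]-oo, t[).
have pE : normal_prob 0 sigma `]-oo, t[ = p%:E.
  by rewrite fineK// fin_num_measure.
have Xp i : P (X i @^-1` `]-oo, t[) = p%:E by rewrite -pE -(X_normal i).
have Xm : (\int[P]_w (Num.max (- X i0 w) 0)%:E = (sigma ^+ 2 * normal_pdf 0 sigma 0)%:E)%E.
  rewrite -expectation_normal_neg//.
  have mneg : measurable_fun [set: R] (fun x : R => Num.max (- x) 0).
    by apply: measurable_maxr => //; exact: measurable_oppr.
  have neg0 x : 0 <= Num.max (- x) 0 :> R by rewrite le_max lexx orbT.
  (* The distribution of [X i0] and [normal_prob] live on two copies of the Borel
     space, so both integrals are compared through their tails. *)
  rewrite ge0_integral_ccdf//; last exact: (measurableT_comp mneg).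
  rewrite (@ge0_integral_ccdf R _ (measurableTypeR R) (normal_prob 0 sigma)
    (fun x => Num.max (- x) 0))//.
  apply: eq_integral => r _; apply: (X_normal i0).
  by rewrite -[X in measurable X]setTI; exact: mneg.
apply: le_trans (expectation_max_ge _ _ P (ltnW d_ge2) X X_indep p _ t (ltW t0) Xp Xm).
rewrite lee_fin sqrM_normal_pdf0//.
have p_half : 1 / 2 <= p by rewrite -lee_fin -pE normal_prob_ge_half.
have := normal_cdf_threshold_pow_le _ sigma_gt0 _ _ d_ge2 pE.
have pd0 : 0 <= p ^+ d.-1 by rewrite exprn_ge0//; lra.
have -> : p ^+ d = p * p ^+ d.-1 by rewrite -exprS prednK// ltnW.
have k0 : 0 <= Num.sqrt (2 / pi) :> R by exact: sqrtr_ge0.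
rewrite -/(threshold _) /t.
move: (p ^+ d.-1) pd0 (threshold _) a1 (Num.sqrt (2 / pi)) k0 (expR _).
move=> q q0 a a1 k k0 e pqe.
(* With q = p^(d-1), replacing the loss sigma k q / 2 by sigma k p q gives sigma a (1 - p q) - sigma
   k p q = sigma (a + k) (1 - p q) - sigma k, the shape of the claim. *)
have le_half : sigma * k * (1 / 2 * q) <= sigma * k * (p * q).
  by apply: ler_wpM2l; [rewrite mulr_ge0// ltW | exact: ler_wpM2r].
have : sigma * (a + k) * (p * q) <= sigma * (a + k) * e.
  by apply: ler_wpM2l => //; rewrite mulr_ge0 ?(ltW sigma_gt0)//; lra.
lra.
Qed.
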